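(* Let $m,n\ge1$. The collection consisting of all $Q$-invariants $Q_i^{(j)}$ ($i\in[m]$, $j\in[n]$, $i+j\le m$), all barred $P$-invariants $\overline{P}_j^{(i)}$ ($i\in[m]$, $j\in[n]$, $i+j\le n$), and the shape invariants $S_1,\dots,S_{\min(m,n)}$ is algebraically independent over $\mathbb{C}$.
   Context: $[k]=\{1,\dots,k\}$. The $x_i^j$ ($i\in[m]$, $j\in[n]$) are independent indeterminates over $\mathbb{C}$. For a cell $s$ in row $a$ and column $b$ of a Young diagram (English notation), $c(s)=a-b$. SSYT are fillings with weakly increasing rows and strictly increasing columns. Unbarred: for $r\in\mathbb{Z}$, $x_i^{(r)}=x_i^j$ where $j\in[n]$, $j\equiv r-i+1\pmod n$. For $\mu\subseteq\lambda$, $s^{(r)}_{\lambda/\mu}=\sum_T\prod_{s\in\lambda/\mu}x_{T(s)}^{(c(s)+r)}$, over SSYT $T$ of shape $\lambda/\mu$ with entries in $[m]$. Barred: for $r\in\mathbb{Z}$, $x_{(r)}^j=x_i^j$ where $i\in[m]$, $i\equiv r-j+1\pmod m$. For $\mu\subseteq\lambda$, $\overline{s}^{(r)}_{\lambda/\mu}=\sum_T\prod_{s\in\lambda/\mu}x^{T(s)}_{(c(s)+r)}$, over SSYT $T$ of shape $\lambda/\mu$ with entries in $[n]$. Shape invariants: $S_k=s^{(n)}_{((n-k+1)^{m-k+1})}$ (a rectangle with $m-k+1$ rows of length $n-k+1$), $1\le k\le\min(m,n)$. $Q$-invariants: for $i+j\le m$, let $0\le K\le n-1$, $K\equiv i+j-m-1\pmod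 n$; $\lambda=((n-j+K+1)^{m-n+K},(n-j)^{m-i-j})$, $\mu=((n-j+1)^{m-n+K-i})$ (exponents are multiplicities); $Q_i^{(j)}=s^{(n-j+1)}_{\lambda/\mu}$. Barred $P$-invariants (same definition with the roles of $m,n$ and of $i,j$ interchanged): for $i+j\le n$, let $0\le K\le m-1$, $K\equiv i+j-n-1\pmod m$; $\lambda=((m-i+K+1)^{n-m+K},(m-i)^{n-i-j})$, $\mu=((m-i+1)^{n-m+K-j})$; $\overline{P}_j^{(i)}=\overline{s}^{(m-i+1)}_{\lambda/\mu}$. *)

(* Defs.v *)
From mathcomp Require Import all_boot all_order all_algebra.
From mathcomp Require Import reals complex mpoly.

Set Implicit Arguments.
Unset Strict Implicit.
Unset Printing Implicit Defensive.

Import GRing.Theory.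
Local Open Scope ring_scope.

(* Rows and columns of cells, and the entries of fillings, are ordinals and    *)
(* hence numbered from 0; this does not affect the content c(s), which is a    *)
(* difference.  The numerical parameters i, j, k of the shapes below are       *)
(* numbered from 1.                                                            *)

(* Partitions are weakly decreasing sequences, so head 0 la is the number of   *)
(* columns of la.                                                              *)
Definition skew_cell (la mu : seq nat) :=
  {s : 'I_(size la) * 'I_(head 0%N la) |
     (nth 0 mu s.1 <= s.2 < nth 0 la s.1)%N}.

Definition cell_row (la mu : seq nat) (s : skew_cell la mu) : nat := (val s).1.
Definition cell_col (la mu : seq nat) (s : skew_cell la mu) : nat := (val s).2.

Definition content (la mu : seq nat) (s : skew_cell la mu) : int :=
  (cell_row s)%:Z - (cell_col s)%:Z.

Definition is_ssyt (m : nat) (la mu : seq nat)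
    (T : {ffun skew_cell la mu -> 'I_m}) : bool :=
  [forall s, forall t,
     (cell_row s == cell_row t) && (cell_col s < cell_col t)%N
       ==> (T s <= T t)%N]
  && [forall s, forall t,
     (cell_col s == cell_col t) && (cell_row s < cell_row t)%N
       ==> (T s < T t)%N].

Definition loop_schur (A : comNzRingType) (m : nat) (y : 'I_m -> int -> A)
    (r : int) (la mu : seq nat) : A :=
  \sum_(T : {ffun skew_cell la mu -> 'I_m} | is_ssyt T)
    \prod_(s : skew_cell la mu) y (T s) (content s + r).

(* The ordinals i and j stand for the 1-based indices i.+1 and j.+1. *)
Definition xvar (F : comNzRingType) (m n : nat) (i : 'I_m) (j : 'I_n) :
    {mpoly F[m * n]} :=
  'X_(mxvec_index i j).

(* x_i^(r).  The residue condition has exactly one solution j as soon as       *)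
(* n > 0, so that the default value 0 is then never used.                      *)
Definition x_unbarred (F : comNzRingType) (m n : nat) (i : 'I_m) (r : int) :
    {mpoly F[m * n]} :=
  if [pick j : 'I_n | (j.+1%:Z == r - i.+1%:Z + 1 %[mod n%:Z])%Z] is Some j
  then xvar F i j else 0.

(* x_(r)^j, likewise for m > 0. *)
Definition x_barred (F : comNzRingType) (m n : nat) (j : 'I_n) (r : int) :
    {mpoly F[m * n]} :=
  if [pick i : 'I_m | (i.+1%:Z == r - j.+1%:Z + 1 %[mod m%:Z])%Z] is Some i
  then xvar F i j else 0.

Definition s_unbarred (F : comNzRingType) (m n : nat) (r : int)
    (la mu : seq nat) : {mpoly F[m * n]} :=
  loop_schur (@x_unbarred F m n) r la mu.

Definition s_barred (F : comNzRingType) (m n : nat) (r : int)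
    (la mu : seq nat) : {mpoly F[m * n]} :=
  loop_schur (@x_barred F m n) r la mu.

Definition shape_invariant (F : comNzRingType) (m n k : nat) :
    {mpoly F[m * n]} :=
  s_unbarred F m n n%:Z (nseq (m - k + 1) (n - k + 1)%N) [::].

(* The K with 0 <= K <= n - 1 and K = i + j - m - 1 mod n. *)
Definition Q_K (m n i j : nat) : nat :=
  `|((i%:Z + j%:Z - m%:Z - 1) %% n%:Z)%Z|%N.

(* For i, j, n > 0 and i + j <= m, we have K = i + j - m - 1 + t * n with      *)
(* t > 0, hence m + K >= n + i: the truncated subtractions are exact.          *)
Definition Q_outer (m n i j : nat) : seq nat :=
  nseq (m + Q_K m n i j - n) (n - j + Q_K m n i j + 1)%N
    ++ nseq (m - i - j) (n - j)%N.

Definition Q_inner (m n i j : nat) : seq nat :=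
  nseq (m + Q_K m n i j - n - i) (n - j + 1)%N.

Definition Q_invariant (F : comNzRingType) (m n i j : nat) :
    {mpoly F[m * n]} :=
  s_unbarred F m n (n - j + 1)%N%:Z (Q_outer m n i j) (Q_inner m n i j).

Definition barred_P_invariant (F : comNzRingType) (m n i j : nat) :
    {mpoly F[m * n]} :=
  s_barred F m n (m - i + 1)%N%:Z (Q_outer n m j i) (Q_inner n m j i).

Definition Q_index (m n : nat) :=
  {ij : 'I_m * 'I_n | (ij.1.+1 + ij.2.+1 <= m)%N}.

Definition P_index (m n : nat) :=
  {ij : 'I_m * 'I_n | (ij.1.+1 + ij.2.+1 <= n)%N}.

Definition invariant_index (m n : nat) : finType :=
  (Q_index m n + P_index m n + 'I_(minn m n))%type.

Definition invariant_family (F : comNzRingType) (m n : nat)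
    (a : invariant_index m n) : {mpoly F[m * n]} :=
  match a with
  | inl (inl ij) => Q_invariant F m n (val ij).1.+1 (val ij).2.+1
  | inl (inr ij) => barred_P_invariant F m n (val ij).1.+1 (val ij).2.+1
  | inr k => shape_invariant F m n k.+1
  end.

Definition algebraically_independent (F : comNzRingType) (N : nat)
    (I : finType) (f : I -> {mpoly F[N]}) : Prop :=
  forall p : {mpoly F[#|I|]},
    p \mPo [tuple f (enum_val k) | k < #|I|] = 0 -> p = 0.

(* Main.v *)
Require Import Defs.
From mathcomp Require Import all_boot all_order all_algebra.
From mathcomp Require Import reals complex mpoly.
From mathcomp Require Import zify.

(** Each invariant is a sum of monomials over tableaux, and for a suitable
    lexicographic order its leading monomial comes from a single extreme
    tableau: the entrywise smallest one for the shape invariants and the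
    Q-invariants, the entrywise largest one for the barred P-invariants.  With
    [corner k] the product of the x_i^j with i + k <= m and j > k, these are
      S_k        : corner (k - 1),
      Q_i^(j)    : corner j, corner (n - K) and x_1^j ... x_i^j  (i + j <= m),
      barred P   : corner i, corner (m - K) and x_a^(n-j+1) ... x_a^n
                   for a = K + 1  (a + n - j + 1 >= m + 2).
    For i + j <= m, differences of consecutive exponents in a column isolate one
    Q-invariant; for i + j >= m + 2, differences in a row isolate one
    P-invariant; on i + j = m + 1 only the shape invariants remain.  Hence the
    exponent vectors are linearly independent and the polynomials are
    algebraically independent. *)

Set Implicit Arguments.
Unset Strict Implicit.
Unset Printing Implicit Defensive.

Import Order.TTheory GRing.Theory.
Local Open Scope ring_scope.

(** * Algebraic independence from leading monomials *)

(** A relation among the [f i] survives any substitution [h]. With [h] a permutation of the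
    variables, this realizes the desired lexicographic order within the fixed monomial order. *)
Lemma algebraically_independent_comp (F : comNzRingType) (N N' : nat)
    (I : finType) (f : I -> {mpoly F[N]}) (h : N.-tuple {mpoly F[N']}) :
  algebraically_independent (fun i => f i \mPo h) ->
  algebraically_independent f.
Proof.
move=> indep p p0; apply: indep.
transitivity ((p \mPo [tuple f (enum_val k) | k < #|I|]) \mPo h); last first.
  by rewrite p0 comp_mpoly0.
rewrite comp_mpolyEX [p \mPo _]comp_mpolyEX rmorph_sum.
apply: eq_bigr => u _; rewrite /= comp_mpolyZ; congr (_ *: _).
rewrite !comp_mpolyX rmorph_prod; apply: eq_bigr => k _ /=.
by rewrite rmorphXn !tnth_mktuple.
Qed.

(** Linear independence of the exponent vectors gives distinct monomials in the [f i] distinct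
    leading monomials, so the largest one in a relation cannot cancel. *)
Lemma algebraically_independent_mlead (F : idomainType) (N : nat)
    (I : finType) (f : I -> {mpoly F[N]}) :
    (forall i, f i != 0) ->
    (forall e e' : I -> nat,
       (forall v, \sum_i mlead (f i) v * e i = \sum_i mlead (f i) v * e' i)%N ->
       e =1 e') ->
  algebraically_independent f.
Proof.
move=> f_neq0 inj_lead p p0; apply/eqP/negPn/negP => p_neq0.
pose mon (u : 'X_{1..#|I|}) : {mpoly F[N]} :=
  'X_[u] \mPo [tuple f (enum_val k) | k < #|I|].
have monE u : mon u = \prod_(k < #|I|) f (enum_val k) ^+ u k.
  by rewrite /mon comp_mpolyX; apply: eq_bigr => k _; rewrite tnth_mktuple.
have fX_neq0 (u : 'X_{1..#|I|}) k : f (enum_val k) ^+ u k != 0.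
  by rewrite expf_neq0.
have mon_neq0 u : mon u != 0.
  by rewrite monE; apply/prodf_neq0 => k _.
have lead_mon u :
    mlead (mon u) = (\sum_(k < #|I|) mlead (f (enum_val k)) *+ u k)%MM.
  rewrite monE mlead_prod; last by move=> k _ _; apply: fX_neq0.
  by apply: eq_bigr => k _; rewrite mleadX.
have lead_inj : injective (fun u => mlead (mon u)).
  move=> u u'; rewrite !lead_mon => eq_lead; apply/mnmP => k.
  suff /(_ (enum_val k)) : u \o enum_rank =1 u' \o enum_rank.
    by rewrite /= enum_valK.
  apply: inj_lead => v /=.
  have sumE (w : 'X_{1..#|I|}) : (\sum_i mlead (f i) v * w (enum_rank i))%N
      = (\sum_(l < #|I|) mlead (f (enum_val l)) *+ w l)%MM v.
    rewrite mnm_sumE (reindex_onto (fun l => enum_val l) enum_rank) /=; last first.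
      by move=> i _; rewrite enum_rankK.
    by apply: eq_big => l; rewrite enum_valK ?eqxx // mulmnE.
  by rewrite !sumE eq_lead.
(* The choice of [u] maximizes the leading monomial after substitution; [u] need not be the leading
   monomial of [p]. *)
have [u u_p max_u] : exists2 u, u \in msupp p &
    forall u', u' \in msupp p -> (mlead (mon u') <= mlead (mon u))%O.
  have := mlead_supp p_neq0; elim: (msupp p) (mlead p) => //= u s IHs u0 _.
  case: s IHs => [|u1 s] IHs; first by exists u => [|u']; rewrite inE // => /eqP->.
  have [u2 u2s max_u2] := IHs u1 (mem_head _ _).
  have [le|/ltW le] := leP (mlead (mon u)) (mlead (mon u2)).
    exists u2 => [|u']; first by rewrite inE u2s orbT.
    by rewrite inE => /predU1P[->|/max_u2].
  exists u => [|u']; first exact: mem_head.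
  by rewrite inE => /predU1P[->|/max_u2/le_trans->].
move/(congr1 (mcoeff (mlead (mon u)))): p0; rewrite comp_mpolyEX mcoeff0.
rewrite raddf_sum (bigD1_seq u) //= big_seq_cond big1 ?addr0.
  rewrite mcoeffZ => /eqP; rewrite mulf_eq0 mleadc_eq0 (negPf (mon_neq0 u)) orbF.
  by move: u_p; rewrite mcoeff_msupp => /negPf->.
move=> u' /andP[u'_p u'_neq]; rewrite mcoeffZ [X in _ * X]mcoeff_gt_mlead ?mulr0 //.
by rewrite lt_neqAle max_u // andbT (inj_eq lead_inj).
Qed.

(** * Leading monomials of sums over tableaux *)

(* Exchanging old variables for new ones lowers a monomial as soon as every
   exchange for a larger variable (of smaller index) is outweighed by the loss
   of a still larger one: look at the largest variable that is moved. *)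
Lemma ltmc_sum_mnm1 (N : nat) (S : finType) (old new : S -> 'I_N) (s0 : S) :
    new s0 != old s0 ->
    (forall s, (new s < old s)%N ->
       exists2 s', (old s' < new s)%N & new s' != old s') ->
  ((\sum_s U_(new s))%MM < (\sum_s U_(old s))%MM)%O.
Proof.
move=> neq0 beaten; apply/ltmcP.
  by rewrite !mdeg_sum; apply: eq_bigr => s _; rewrite !mdeg1.
(* A smaller index is a larger variable. At a moved [s] with least [low s], the first exponent to
   differ is that of [old s], and it drops. *)
pose low s := minn (old s) (new s).
case: (@arg_minnP S s0 (fun s => new s != old s) low neq0) => s neq_s min_s.
have no_new s' : (new s' <= low s)%N -> (new s' < old s')%N -> False.
  move=> le_new /beaten[s2 lt2 /min_s]; rewrite /low in le_new *; lia.
have lt_s : (old s < new s)%N.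
  rewrite ltnNge leq_eqVlt; apply/negP => /orP[/eqP eq_s|lt_s].
    by move/eqP: neq_s; apply; apply/val_inj.
  by apply: (no_new s) => //; rewrite /low; lia.
exists (old s) => [v lt_v|]; rewrite !mnm_sumE.
  apply: eq_bigr => s' _; rewrite !mnm1E; have [-> //|neq] := eqVneq (new s') (old s').
  have := min_s s' neq; rewrite /low -!val_eqE /=; lia.
apply: (@leq_ltn_trans (\sum_(s' | s' != s) U_(old s')%MM (old s))%N); last first.
  by rewrite [ltnRHS](bigD1 s) //= mnm1E eqxx; lia.
rewrite (bigD1 s) //= mnm1E -val_eqE /= gtn_eqF // add0n.
apply: leq_sum => s' _; rewrite !mnm1E; have [-> //|neq] := eqVneq (new s') (old s').
case: eqP => // eq_new; exfalso; apply: (no_new s') => //.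
  by rewrite eq_new /low; lia.
have := min_s s' neq; rewrite /low eq_new; move: neq; rewrite -val_eqE eq_new /=; lia.
Qed.

(** By [ltmc_sum_mnm1] every other tableau has a strictly smaller monomial, so that of [T0] has
    coefficient 1. Injectivity of [v] turns a changed entry into a changed variable. *)
Lemma mlead_loop_schur (F : comNzRingType) (N A : nat)
    (y : 'I_A -> int -> {mpoly F[N]}) (v : 'I_A -> int -> 'I_N) (r : int)
    (la mu : seq nat) (T0 : {ffun skew_cell la mu -> 'I_A}) :
    (forall t c, y t c = 'X_(v t c)) ->
    (forall c, injective (v^~ c)) ->
    is_ssyt T0 ->
    (forall T : {ffun skew_cell la mu -> 'I_A}, is_ssyt T ->
     forall s : skew_cell la mu,
       (v (T s) (content s + r)%R < v (T0 s) (content s + r)%R)%N ->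
     exists2 s' : skew_cell la mu,
         (v (T0 s') (content s' + r)%R < v (T s) (content s + r)%R)%N
               & T s' != T0 s') ->
  loop_schur y r la mu != 0 /\
  mlead (loop_schur y r la mu) =
    (\sum_(s : skew_cell la mu) U_(v (T0 s) (content s + r)%R))%MM.
Proof.
move=> yE v_inj T0_ssyt beaten.
pose mon (T : {ffun skew_cell la mu -> 'I_A}) : 'X_{1..N} :=
  (\sum_(s : skew_cell la mu) U_(v (T s) (content s + r)%R))%MM.
have lt_mon T : is_ssyt T -> T != T0 -> (mon T < mon T0)%O.
  move=> T_ssyt neqT; have [s neq_s] : exists s, T s != T0 s.
    apply/existsP; rewrite -negb_forall; apply: contra neqT => /forallP eqT.
    by apply/eqP/ffunP => s; apply/eqP.
  apply: (ltmc_sum_mnm1 (s0 := s)); first by rewrite (inj_eq (v_inj _)).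
  move=> s1 /(beaten _ T_ssyt)[s2 lt2 neq2]; exists s2 => //.
  by rewrite (inj_eq (v_inj _)).
have schurE : loop_schur y r la mu = \sum_(T | is_ssyt T) 'X_[mon T].
  apply: eq_bigr => T _; rewrite /mon -mprodXE.
  by apply: eq_bigr => s _; rewrite yE.
have coef0 : (loop_schur y r la mu)@_(mon T0) = 1.
  rewrite schurE raddf_sum (bigD1 T0) //= mcoeffX eqxx big1 ?addr0 // => T /andP[T_ssyt neqT].
  by rewrite mcoeffX lt_eqF // lt_mon.
split.
  by apply/eqP => eq0; move: coef0; rewrite eq0 mcoeff0 => /eqP; rewrite eq_sym oner_eq0.
apply/le_anti/andP; split; last first.
  by apply: msupp_le_mlead; rewrite mcoeff_msupp coef0 oner_neq0.
rewrite schurE; apply: (le_trans (mlead_sum_le _ _ _)); apply/joinsP_seq => T _ T_ssyt.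
by rewrite mleadXm; have [-> //|/lt_mon/ltW->] := eqVneq T T0.
Qed.

(** * Block shapes and their extreme tableaux *)

(* All the shapes consist of c columns occupying the rows p..L+d-1, one column
   occupying the rows p..L-1 and K columns occupying the rows 0..L-1.  The
   rectangles of the shape invariants are the case L = 0. *)
Definition block_outer (L c K d : nat) : seq nat :=
  nseq L (c + K + 1)%N ++ nseq d c.

Definition block_inner (p c : nat) : seq nat := nseq p (c + 1)%N.

Notation block_cell L c K d p :=
  (skew_cell (block_outer L c K d) (block_inner p c)).

Definition in_block (L c K d p a b : nat) : bool :=
  [|| (b < c) && (p <= a < L + d), (b == c) && (p <= a < L)
    | (c < b <= c + K) && (a < L)]%N.

Lemma in_blockE (L c K d p a b : nat) : (p <= L)%N ->
  ((a < size (block_outer L c K d)) && (b < head 0 (block_outer L c K d)) &&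
   (nth 0 (block_inner p c) a <= b < nth 0 (block_outer L c K d) a))%N
  = in_block L c K d p a b.
Proof.
move=> le_pL; rewrite /in_block /block_outer /block_inner size_cat !size_nseq.
rewrite nth_cat !nth_nseq size_nseq.
have -> : head 0%N (nseq L (c + K + 1)%N ++ nseq d c)
    = (if (0 < L)%N then c + K + 1 else if (0 < d)%N then c else 0)%N.
  by case: (L) => [|?]; case: (d).
by case: (ltnP 0 L); case: (ltnP 0 d); case: (ltnP a L);
  case: (ltnP a p); case: (ltnP (a - L) d); lia.
Qed.

Lemma block_cellP (L c K d p : nat) (le_pL : (p <= L)%N)
    (s : block_cell L c K d p) :
  in_block L c K d p (cell_row s) (cell_col s).
Proof.
by rewrite -in_blockE // /cell_row /cell_col; case: s => [[a b] /= ->]; rewrite !ltn_ord.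
Qed.

Lemma block_cell_exists (L c K d p a b : nat) :
    (p <= L)%N -> in_block L c K d p a b ->
  exists s : block_cell L c K d p,
    cell_row s = a /\ cell_col s = b.
Proof.
move=> le_pL; rewrite -in_blockE // => /andP[/andP[lt_a lt_b] ab].
by exists (Sub (Ordinal lt_a, Ordinal lt_b) ab).
Qed.

Lemma cell_inj (la mu : seq nat) (s t : skew_cell la mu) :
  cell_row s = cell_row t -> cell_col s = cell_col t -> s = t.
Proof.
move=> eq_row eq_col; apply: val_inj.
rewrite [val s]surjective_pairing [val t]surjective_pairing.
by congr (_, _); apply: val_inj.
Qed.

(** A position carries at most one cell. The guard [g] is meant for conditions on a variable rather
    than on the cell. *)
Lemma sum_block_cell (L c K d p a b : nat) (g : bool) : (p <= L)%N ->
  (\sum_(s : block_cell L c K d p)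
     [&& g, cell_row s == a & cell_col s == b] = g && in_block L c K d p a b)%N.
Proof.
move=> le_pL; case: g => /=; last by rewrite big1.
case: (boolP (in_block L c K d p a b)) => [ab|abN].
  have [s0 [row0 col0]] := block_cell_exists le_pL ab.
  rewrite (bigD1 s0) //= row0 col0 !eqxx big1 // => s neq_s.
  apply/eqP; rewrite eqb0; apply: contra neq_s => /andP[/eqP eq_row /eqP eq_col].
  by apply/eqP/cell_inj; rewrite ?row0 ?col0.
rewrite big1 // => s _; apply/eqP; rewrite eqb0; apply: contra abN.
by move=> /andP[/eqP<- /eqP<-]; apply: block_cellP.
Qed.

(** Columns of a block shape have no gaps, so entries grow by at least one per row. *)
Lemma ssyt_column (A L c K d p : nat) (le_pL : (p <= L)%N)
    (T : {ffun block_cell L c K d p -> 'I_A})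
    (s t : block_cell L c K d p) :
    is_ssyt T -> cell_col s = cell_col t -> (cell_row s <= cell_row t)%N ->
  (T s + (cell_row t - cell_row s) <= T t)%N.
Proof.
move=> /andP[_ /forallP col_lt] eq_col.
move def_k: (cell_row t - cell_row s)%N => k.
elim: k t eq_col def_k => [|k IHk] t eq_col def_k le_row.
  by rewrite addn0 (_ : s = t) //; apply: cell_inj => //; lia.
have [t' [row_t' col_t']] : exists t' : block_cell L c K d p,
    cell_row t' = (cell_row t).-1 /\ cell_col t' = cell_col t.
  apply: block_cell_exists => //.
  have := block_cellP le_pL s; have := block_cellP le_pL t.
  by rewrite /in_block eq_col; lia.
have := IHk t' _ _ _; rewrite row_t' col_t' => /(_ eq_col) IH.
have /forallP/(_ t)/implyP := col_lt t'.
rewrite row_t' col_t' eqxx /= => lt_t'.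
by have := IH ltac:(lia) ltac:(lia); have := lt_t' ltac:(lia); lia.
Qed.

Definition block_top (p c b : nat) : nat := if (b <= c)%N then p else 0%N.

Definition block_bot (L c d b : nat) : nat := if (b < c)%N then (L + d)%N else L.

Lemma ssyt_bounds (A L c K d p : nat) (le_pL : (p <= L)%N)
    (T : {ffun block_cell L c K d p -> 'I_A})
    (s : block_cell L c K d p) :
  is_ssyt T ->
  (cell_row s <= T s + block_top p c (cell_col s))%N /\
  (T s + block_bot L c d (cell_col s) <= A + cell_row s)%N.
Proof.
move=> T_ssyt; have s_in := block_cellP le_pL s; split.
  have [s1 [row1 col1]] : exists s1 : block_cell L c K d p,
      cell_row s1 = block_top p c (cell_col s) /\ cell_col s1 = cell_col s.
    apply: block_cell_exists => //; move: s_in.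
    by rewrite /in_block /block_top; case: (leqP (cell_col s) c); lia.
  have := ssyt_column le_pL T_ssyt col1; rewrite row1.
  have le_top : (block_top p c (cell_col s) <= cell_row s)%N.
    by move: s_in; rewrite /in_block /block_top; case: (leqP (cell_col s) c); lia.
  by move=> /(_ le_top); lia.
have [s1 [row1 col1]] : exists s1 : block_cell L c K d p,
    cell_row s1 = (block_bot L c d (cell_col s)).-1 /\ cell_col s1 = cell_col s.
  apply: block_cell_exists => //; move: s_in.
  by rewrite /in_block /block_bot; case: (ltnP (cell_col s) c); lia.
have := ssyt_column le_pL T_ssyt (esym col1); have := ltn_ord (T s1); rewrite row1.
have lt_bot : (cell_row s < block_bot L c d (cell_col s))%N.
  by move: s_in; rewrite /in_block /block_bot; case: (ltnP (cell_col s) c); lia.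
by move=> lt_T /(_ ltac:(lia)); lia.
Qed.

Lemma is_ssytI (A : nat) (la mu : seq nat) (T : {ffun skew_cell la mu -> 'I_A}) :
    (forall s t : skew_cell la mu, cell_row s = cell_row t -> (cell_col s < cell_col t)%N ->
       (T s <= T t)%N) ->
    (forall s t : skew_cell la mu, cell_col s = cell_col t -> (cell_row s < cell_row t)%N ->
       (T s < T t)%N) ->
  is_ssyt T.
Proof.
move=> row_le col_lt; apply/andP; split; apply/forallP => s; apply/forallP => t;
  by apply/implyP => /andP[/eqP eq_st lt_st]; auto.
Qed.

(** The filling attains the lower bound of [ssyt_bounds]. Its rows increase weakly because column
    tops never descend from left to right. *)
Lemma min_ssyt (A' L c K d p : nat) : (p <= L)%N ->
    (L + d <= A'.+1 + p)%N -> (L <= A'.+1)%N ->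
  exists2 T : {ffun block_cell L c K d p -> 'I_A'.+1},
    is_ssyt T & forall s : block_cell L c K d p,
      (T s + block_top p c (cell_col s))%N = cell_row s.
Proof.
move=> le_pL le_A1 le_A2.
have [T TE] : exists T : {ffun block_cell L c K d p -> 'I_A'.+1},
    forall s : block_cell L c K d p, (T s + block_top p c (cell_col s))%N = cell_row s.
  exists [ffun s => inord (cell_row s - block_top p c (cell_col s))] => s.
  have := block_cellP le_pL s; rewrite ffunE /in_block /block_top => s_in.
  by rewrite inordK; case: (leqP (cell_col s) c) s_in; lia.
exists T => //; apply: is_ssytI => s t;
  have := TE s; have := TE t; rewrite /block_top;
  case: (leqP (cell_col s) c); case: (leqP (cell_col t) c); lia.
Qed.

(** The filling attains the upper bound of [ssyt_bounds]; here it is the column bottoms that never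
    descend from left to right. *)
Lemma max_ssyt (A' L c K d p : nat) : (p <= L)%N ->
    (L + d <= A'.+1 + p)%N -> (L <= A'.+1)%N ->
  exists2 T : {ffun block_cell L c K d p -> 'I_A'.+1},
    is_ssyt T & forall s : block_cell L c K d p,
      (T s + block_bot L c d (cell_col s) = A'.+1 + cell_row s)%N.
Proof.
move=> le_pL le_A1 le_A2.
have [T TE] : exists T : {ffun block_cell L c K d p -> 'I_A'.+1},
    forall s : block_cell L c K d p,
      (T s + block_bot L c d (cell_col s) = A'.+1 + cell_row s)%N.
  exists [ffun s => inord (A'.+1 + cell_row s - block_bot L c d (cell_col s))] => s.
  have := block_cellP le_pL s; rewrite ffunE /in_block /block_bot => s_in.
  by rewrite inordK; case: (ltnP (cell_col s) c) s_in; lia.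
exists T => //; apply: is_ssytI => s t;
  have := TE s; have := TE t; rewrite /block_bot;
  case: (ltnP (cell_col s) c); case: (ltnP (cell_col t) c); lia.
Qed.

(** * The order of the variables and superscripts modulo [n] or [m] *)

(* The lexicographic order compares rows first when n <= m, and columns first
   otherwise: this is what makes the wrapped variables lose. *)
Definition var_code (m n x y : nat) : nat :=
  if (n <= m)%N then (x * n + (n - y.+1))%N else ((n - y.+1) * m + x)%N.

Lemma var_code_lt (m n x y : nat) :
  (x < m)%N -> (y < n)%N -> (var_code m n x y < m * n)%N.
Proof. by rewrite /var_code; case: (leqP n m); nia. Qed.

(** Both orders agree on this: moving a variable down or to the left raises its code and so makes it
    smaller. *)
Lemma var_code_anti (m n x y x' y' : nat) :
    (x <= x' < m)%N -> (y' <= y < n)%N -> ((x < x') || (y' < y))%N ->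
  (var_code m n x y < var_code m n x' y')%N.
Proof. by rewrite /var_code; case: (leqP n m); nia. Qed.

Lemma var_code_row (m n x y x' y' : nat) :
    (n <= m)%N -> (x < x' < m)%N -> (y < n)%N -> (y' < n)%N ->
  (var_code m n x y < var_code m n x' y')%N.
Proof. by rewrite /var_code => ->; nia. Qed.

Lemma var_code_col (m n x y x' y' : nat) :
    (m < n)%N -> (y' < y < n)%N -> (x < m)%N -> (x' < m)%N ->
  (var_code m n x y < var_code m n x' y')%N.
Proof. by move=> lt_mn; rewrite /var_code (leqNgt n) lt_mn /=; nia. Qed.

Lemma var_code_inj (m n x y x' y' : nat) :
    (x < m)%N -> (y < n)%N -> (x' < m)%N -> (y' < n)%N ->
  var_code m n x y = var_code m n x' y' -> x = x' /\ y = y'.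
Proof.
move=> lt_x lt_y lt_x' lt_y' eq_code.
case: (leqP n m) => le_nm.
  have eq_x : x = x'.
    by case: (ltngtP x x') => // lt_xx';
      [have := @var_code_row m n x y x' y' | have := @var_code_row m n x' y' x y]; lia.
  split=> //; case: (ltngtP y y') => // lt_yy';
    [have := @var_code_anti m n x' y' x y | have := @var_code_anti m n x y x' y']; lia.
have eq_y : y = y'.
  by case: (ltngtP y y') => // lt_yy';
    [have := @var_code_col m n x' y' x y | have := @var_code_col m n x y x' y']; lia.
split=> //; case: (ltngtP x x') => // lt_xx';
  [have := @var_code_anti m n x y x' y' | have := @var_code_anti m n x' y' x y]; lia.
Qed.

Definition var_index (m n : nat) (i : 'I_m) (j : 'I_n) : 'I_(m * n) :=
  Ordinal (var_code_lt (ltn_ord i) (ltn_ord j)).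

Lemma var_index_eq (m n : nat) (i i' : 'I_m) (j j' : 'I_n) :
  (var_index i j == var_index i' j') = (i == i' :> nat) && (j == j' :> nat).
Proof.
apply/eqP/andP => [/(congr1 val)/=|[/eqP eq_i /eqP eq_j]]; last first.
  by apply: val_inj; rewrite /= eq_i eq_j.
by move=> /var_code_inj[] // -> ->.
Qed.

(** The entries of [mxvec] follow the indexing used by [xvar], so substitution renames the variable
    of row [i] and column [j] to the one with index [var_index i j]. *)
Definition var_reindex (F : comNzRingType) (m n : nat) :
    (m * n).-tuple {mpoly F[m * n]} :=
  [tuple 'X_(mxvec (\matrix_(i < m, j < n) var_index i j) 0 k) | k < m * n].

Lemma xvar_reindex (F : comNzRingType) (m n : nat) (i : 'I_m) (j : 'I_n) :
  xvar F i j \mPo var_reindex F m n = 'X_(var_index i j).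
Proof. by rewrite /xvar comp_mpolyXU -tnth_nth tnth_mktuple mxvecE mxE. Qed.

Definition residue (n' : nat) (r : int) : 'I_n'.+1 :=
  inord `|(r %% n'.+1%:Z)%Z|%N.

Lemma residueE (n' k : nat) (r q : int) :
  (k < n'.+1)%N -> r = q * n'.+1%:Z + k%:Z -> residue n' r = k :> nat.
Proof. by move=> lt_k ->; rewrite /residue modzMDl modz_small ?inordK //; lia. Qed.

(** Numbering from 0 absorbs the [+ 1] in the congruences of [x_unbarred] and [x_barred]. *)
Lemma residue_eqmod (n' : nat) (j : 'I_n'.+1) (r : int) :
  (j.+1%:Z == r + 1 %[mod n'.+1%:Z])%Z = (j == residue n' r).
Proof.
have -> : j.+1%:Z = j%:Z + 1 by lia.
rewrite eqz_modDr /residue -val_eqE /=.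
have lt_mod : (`|(r %% n'.+1%:Z)%Z| < n'.+1)%N.
  have := @ltz_pmod r n'.+1%:Z isT; have := @modz_ge0 r n'.+1%:Z isT; lia.
rewrite inordK // (@modz_small j%:Z); last by have := ltn_ord j; lia.
by have := @modz_ge0 r n'.+1%:Z isT; lia.
Qed.

Lemma x_unbarredE (F : comNzRingType) (m n' : nat) (i : 'I_m) (r : int) :
  x_unbarred F n'.+1 i r = xvar F i (residue n' (r - i.+1%:Z)).
Proof.
rewrite /x_unbarred; case: pickP => [j|none].
  by rewrite residue_eqmod => /eqP->.
by have := none (residue n' (r - i.+1%:Z)); rewrite residue_eqmod eqxx.
Qed.

Lemma x_barredE (F : comNzRingType) (m' n : nat) (j : 'I_n) (r : int) :
  x_barred F m'.+1 j r = xvar F (residue m' (r - j.+1%:Z)) j.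
Proof.
rewrite /x_barred; case: pickP => [i|none].
  by rewrite residue_eqmod => /eqP->.
by have := none (residue m' (r - j.+1%:Z)); rewrite residue_eqmod eqxx.
Qed.

Lemma loop_schur_comp (F : comNzRingType) (N N' A : nat)
    (h : N.-tuple {mpoly F[N']}) (y : 'I_A -> int -> {mpoly F[N]}) (r : int)
    (la mu : seq nat) :
  loop_schur y r la mu \mPo h = loop_schur (fun t c => y t c \mPo h) r la mu.
Proof.
rewrite /loop_schur rmorph_sum; apply: eq_bigr => T _ /=.
by rewrite rmorph_prod.
Qed.

(** * Leading monomials for block shapes *)

(* Raising an entry from its minimal value t to t + s moves the variable s
   columns to the left.  Only a cell of the middle column can wrap around to a
   larger variable.  This requires m < n, and then the cell to its right is
   raised too and loses a still larger variable. *)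
Lemma mlead_min_block (F : comNzRingType) (m' n' L c K d p J q : nat) (r : int) :
    (p <= L)%N -> (0 < J)%N -> (p.+1 = J + q * n'.+1)%N ->
    (L + d <= m'.+1 + p)%N -> (L <= m'.+1)%N ->
    (c + m'.+1 + p <= n'.+1 + (L + d))%N -> (c <= n'.+1)%N ->
    ((0 < L)%N -> [/\ (c + J = n'.+1)%N, (K + m'.+1 <= n'.+1 + L)%N,
       (L + J <= m'.+1 + p)%N & (m'.+1 < n'.+1)%N -> q = 0%N /\ (0 < K)%N]) ->
    r = n'.+1%:Z - J%:Z + 1 ->
  let f := loop_schur
    (fun t c => 'X_(var_index t (residue n' (c - t.+1%:Z))) :
       {mpoly F[m'.+1 * n'.+1]})
    r (block_outer L c K d) (block_inner p c) in
  f != 0 /\ forall (x : 'I_m'.+1) (y : 'I_n'.+1), mlead f (var_index x y) =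
    (((x + p < L + d) && (n'.+1 <= c + y)) + ((y.+1 == J) && (x + p < L))
     + ((n'.+1 <= y + K) && (x < L)))%N.
Proof.
move=> le_pL J_gt0 pE le_Lm1 le_Lm2 le_left le_cn mid rE f.
have [T0 T0_ssyt T0E] := @min_ssyt m' L c K d p le_pL le_Lm1 le_Lm2.
(* This is the column of the variable that entry [t] contributes at [s]. In the next four claims [u]
   is the excess of [t] over the minimal entry. *)
pose res (s : block_cell L c K d p) (t : nat) : nat :=
  residue n' (content s + r - t.+1%:Z).
have res_left (s : block_cell L c K d p) (t u : nat) :
    (cell_col s < c)%N -> (t + p = cell_row s + u)%N ->
    (cell_col s + u < n'.+1)%N -> (res s t + cell_col s + u = n')%N.
  move=> lt_c tE lt_n; rewrite /res.
  rewrite (@residueE n' (n' - cell_col s - u) _ q%:Z); first by lia.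
    by lia.
  by rewrite rE /content; lia.
have res_right (s : block_cell L c K d p) (t u : nat) :
    (0 < L)%N -> (c < cell_col s)%N -> (t = cell_row s + u)%N ->
    (cell_col s + u <= n'.+1 + c)%N -> (res s t + cell_col s + u = n'.+1 + c)%N.
  move=> L_gt0 lt_c tE le_n; rewrite /res; have [cE _ _ _] := mid L_gt0.
  rewrite (@residueE n' (n'.+1 + c - cell_col s - u) _ (-1)); first by lia.
    by lia.
  by rewrite rE /content; lia.
have res_mid (s : block_cell L c K d p) (t u : nat) :
    (0 < L)%N -> cell_col s = c -> (t + p = cell_row s + u)%N -> (u < J)%N ->
    (res s t + u.+1 = J)%N.
  move=> L_gt0 col_s tE lt_u; rewrite /res; have [cE _ _ _] := mid L_gt0.
  rewrite (@residueE n' (J - u.+1) _ q%:Z); first by lia.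
    by lia.
  by rewrite rE /content; lia.
have res_wrap (s : block_cell L c K d p) (t u : nat) :
    (0 < L)%N -> cell_col s = c -> (t + p = cell_row s + u)%N ->
    (J <= u < J + n'.+1)%N -> (res s t + u.+1 = J + n'.+1)%N.
  move=> L_gt0 col_s tE lt_u; rewrite /res; have [cE _ _ _] := mid L_gt0.
  rewrite (@residueE n' (J + n'.+1 - u.+1) _ (q%:Z - 1)); first by lia.
    by lia.
  by rewrite rE /content; lia.
have [f_neq0 f_lead] : f != 0 /\ mlead f
    = (\sum_(s : block_cell L c K d p)
         U_(var_index (T0 s) (residue n' (content s + r - (T0 s).+1%:Z)%R)))%MM.
  apply: (mlead_loop_schur
    (v := fun t c => var_index t (residue n' (c - t.+1%:Z)))) => //.
    by move=> k t t' /eqP; rewrite var_index_eq => /andP[/eqP/val_inj].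
  move=> T T_ssyt s /=; rewrite -!/(res s _).
  have [T_lo T_hi] := ssyt_bounds le_pL s T_ssyt.
  have T0s := T0E s; have s_in := block_cellP le_pL s.
  have lt_T := ltn_ord (T s); have lt_T0 := ltn_ord (T0 s).
  have lt_res t : (res s t < n'.+1)%N by apply: ltn_ord.
  have [eqT|neqT] := eqVneq (T s : nat) (T0 s); first by rewrite eqT ltnn.
  (* With rows compared first, raising an entry always gives a smaller variable. *)
  case: (leqP n'.+1 m'.+1) => [le_nm|lt_mn] lt_code.
    exfalso; have lt_T0T : (T0 s < T s < m'.+1)%N by lia.
    have := var_code_row le_nm lt_T0T (lt_res (T0 s)) (lt_res (T s)).
    by lia.
  have antiN : ~ (res s (T s) < res s (T0 s))%N.
    move=> lt_r; have le_T0T : (T0 s <= T s < m'.+1)%N by lia.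
    have le_r : (res s (T s) <= res s (T0 s) < n'.+1)%N by rewrite ltnW // lt_res.
    by have := var_code_anti le_T0T le_r; rewrite lt_r orbT => /(_ isT); lia.
  move: T_lo T_hi T0s s_in; rewrite /block_top /block_bot /in_block.
  case: (ltngtP (cell_col s) c) => /= col_s T_lo T_hi T0s s_in.
  - case: antiN; have := res_left s (T s) (T s + p - cell_row s)%N.
    have := res_left s (T0 s) 0%N; lia.
  - have L_gt0 : (0 < L)%N by lia.
    have [cE le_K le_J /(_ lt_mn)[q0 K_gt0]] := mid L_gt0.
    case: antiN; have := res_right s (T s) (T s - cell_row s)%N.
    have := res_right s (T0 s) 0%N; lia.
  have L_gt0 : (0 < L)%N by lia.
  have [cE le_K le_J /(_ lt_mn)[q0 K_gt0]] := mid L_gt0.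
  (* In the middle column the minimal entry gives column [J - 1], counted from 0, so the variable
     wraps once the excess reaches [J]. *)
  case: (ltnP (T s + p - cell_row s) J) => [lt_J|le_Ju].
    case: antiN; have := res_mid s (T s) (T s + p - cell_row s)%N.
    have := res_mid s (T0 s) 0%N; lia.
  (* The right neighbour exists because [K > 0]. Its minimal variable lies in the last column and in
     row [cell_row s], which is less than [T s] because [q = 0] gives [p + 1 = J]. *)
  have [s' [row_s' col_s']] : exists s' : block_cell L c K d p,
      cell_row s' = cell_row s /\ cell_col s' = c.+1.
    by apply: block_cell_exists => //; rewrite /in_block; lia.
  have T0s' := T0E s'; rewrite row_s' col_s' /block_top ltnn in T0s'.
  have T_ss' : (T s <= T s')%N.
    have /andP[/forallP/(_ s)/forallP/(_ s')/implyP le_row _] := T_ssyt.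
    by apply: le_row; rewrite row_s' col_s' col_s eqxx /=.
  have resT := res_wrap s (T s) (T s + p - cell_row s)%N.
  have resT0' := res_right s' (T0 s') 0%N.
  rewrite row_s' col_s' in resT0'.
  exists s'; last by rewrite -val_eqE /=; lia.
  rewrite -/(res s' _); apply: var_code_anti; lia.
split=> // x y; rewrite f_lead mnm_sumE; have lt_y := ltn_ord y.
(* Solving for the cell: a variable determines one position in each of the three groups of columns,
   with its range condition as guard. *)
transitivity (\sum_(s : block_cell L c K d p)
  ([&& (n'.+1 <= c + y)%N, cell_row s == x + p & cell_col s == n' - y]%N
   + [&& y.+1 == J, cell_row s == x + p & cell_col s == c]%N
   + [&& (n'.+1 <= y + K)%N, cell_row s == x & cell_col s == n'.+1 + c - y]%N))%N;
  last first.
  rewrite !big_split /= !sum_block_cell // /in_block; congr (_ + _ + _)%N; lia.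
apply: eq_bigr => s _; rewrite mnm1E var_index_eq -/(res s _).
have T0s := T0E s; have s_in := block_cellP le_pL s.
have lt_r : (res s (T0 s) < n'.+1)%N by apply: ltn_ord.
move: T0s s_in; rewrite /block_top /in_block.
case: (ltngtP (cell_col s) c) => /= col_s T0s s_in.
- have resT0 : (res s (T0 s) + cell_col s = n')%N.
    by have := res_left s (T0 s) 0%N; lia.
  rewrite (_ : [&& _, _ & cell_col s == n'.+1 + c - y]%N = false); last by lia.
  rewrite !andbF !addn0; congr nat_of_bool; apply/idP/idP; lia.
- have L_gt0 : (0 < L)%N by lia.
  have resT0 : (res s (T0 s) + cell_col s = n'.+1 + c)%N.
    by have [_ le_K _ _] := mid L_gt0; rewrite -[RHS](res_right s (T0 s) 0%N); lia.
  rewrite (_ : [&& _, _ & cell_col s == n' - y]%N = false); last by lia.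
  rewrite !andbF !add0n; congr nat_of_bool; apply/idP/idP; lia.
have L_gt0 : (0 < L)%N by lia.
have resT0 : (res s (T0 s) + 1 = J)%N.
  by rewrite -[RHS](res_mid s (T0 s) 0%N); lia.
rewrite (_ : [&& _, _ & cell_col s == n' - y]%N = false); last by lia.
rewrite (_ : [&& _, _ & cell_col s == n'.+1 + c - y]%N = false); last by lia.
rewrite addn0 add0n; congr nat_of_bool; apply/idP/idP; lia.
Qed.

(** The mirror image: lowering an entry from its maximal value moves the variable to a later row,
    and only the middle column can wrap. A gain requires [n <= m], and then the left neighbour is
    lowered too and loses a still larger variable. *)
Lemma mlead_max_block (F : comNzRingType) (m' n' L c K d p i q : nat) (r : int) :
    (p <= L)%N -> (c + i = m'.+1)%N -> (L + d + 1 = n'.+1 + q * m'.+1)%N ->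
    (L + m'.+1 = n'.+1 + K)%N -> (K <= m')%N -> (L + d + i = n'.+1 + p)%N ->
    ((n'.+1 <= m'.+1)%N -> q = 0%N /\ (0 < c)%N) ->
    r = m'.+1%:Z - i%:Z + 1 ->
  let f := loop_schur
    (fun t c => 'X_(var_index (residue m' (c - t.+1%:Z)) t) :
       {mpoly F[m'.+1 * n'.+1]})
    r (block_outer L c K d) (block_inner p c) in
  f != 0 /\ forall (x : 'I_m'.+1) (y : 'I_n'.+1), mlead f (var_index x y) =
    (((x < c) && (i <= y)) + ((x == K :> nat) && (n'.+1 + p <= y + L))
     + ((x < K) && (m'.+1 <= y + K)))%N.
Proof.
move=> le_pL cE LdE LE le_Km lenE wide rE f.
have le_Ln1 : (L + d <= n'.+1 + p)%N by lia.
have le_Ln2 : (L <= n'.+1)%N by lia.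
have [T0 T0_ssyt T0E] := @max_ssyt n' L c K d p le_pL le_Ln1 le_Ln2.
pose res (s : block_cell L c K d p) (t : nat) : nat :=
  residue m' (content s + r - t.+1%:Z).
have res_left (s : block_cell L c K d p) (t u : nat) :
    (cell_col s < c)%N -> (t + u + L + d = n'.+1 + cell_row s)%N ->
    (u <= i)%N -> (res s t + cell_col s + 1 = c + u)%N.
  move=> lt_c tE lt_n; rewrite /res.
  rewrite (@residueE m' (c + u - (cell_col s).+1) _ q%:Z); first by lia.
    by lia.
  by rewrite rE /content; lia.
have res_right (s : block_cell L c K d p) (t u : nat) :
    (c < cell_col s <= c + K)%N -> (t + u + L = n'.+1 + cell_row s)%N ->
    (K + u <= m'.+1)%N -> (res s t + cell_col s = K + u + c)%N.
  move=> lt_c tE le_n; rewrite /res.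
  rewrite (@residueE m' (K + u + c - cell_col s) _ (-1)); first by lia.
    by lia.
  by rewrite rE /content; lia.
have res_mid (s : block_cell L c K d p) (t u : nat) :
    cell_col s = c -> (t + u + L = n'.+1 + cell_row s)%N -> (K + u <= m')%N ->
    (res s t = K + u)%N.
  move=> col_s tE lt_u; rewrite /res.
  rewrite (@residueE m' (K + u) _ (-1)); first by lia.
    by lia.
  by rewrite rE /content; lia.
have [f_neq0 f_lead] : f != 0 /\ mlead f
    = (\sum_(s : block_cell L c K d p)
         U_(var_index (residue m' (content s + r - (T0 s).+1%:Z)%R) (T0 s)))%MM.
  apply: (mlead_loop_schur
    (v := fun t c => var_index (residue m' (c - t.+1%:Z)) t)) => //.
    by move=> k t t' /eqP; rewrite var_index_eq => /andP[_ /eqP/val_inj].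
  move=> T T_ssyt s /=; rewrite -!/(res s _).
  have [T_lo T_hi] := ssyt_bounds le_pL s T_ssyt.
  have T0s := T0E s; have s_in := block_cellP le_pL s.
  have lt_T := ltn_ord (T s); have lt_T0 := ltn_ord (T0 s).
  have lt_res t : (res s t < m'.+1)%N by apply: ltn_ord.
  have [eqT|neqT] := eqVneq (T s : nat) (T0 s); first by rewrite eqT ltnn.
  case: (leqP n'.+1 m'.+1) => [le_nm|lt_mn] lt_code; last first.
    exfalso; have lt_TT0 : (T s < T0 s < n'.+1)%N by lia.
    have := var_code_col lt_mn lt_TT0 (lt_res (T0 s)) (lt_res (T s)).
    by lia.
  have [q0 c_gt0] := wide le_nm.
  have antiN : ~ (res s (T0 s) < res s (T s))%N.
    move=> lt_r; have le_TT0 : (T s <= T0 s < n'.+1)%N by lia.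
    have le_r : (res s (T0 s) <= res s (T s) < m'.+1)%N by rewrite ltnW // lt_res.
    by have := var_code_anti le_r le_TT0; rewrite lt_r => /(_ isT); lia.
  move: T_lo T_hi T0s s_in; rewrite /block_top /block_bot /in_block.
  case: (ltngtP (cell_col s) c) => /= col_s T_lo T_hi T0s s_in.
  - case: antiN; have := res_left s (T s) (T0 s - T s)%N.
    have := res_left s (T0 s) 0%N; lia.
  - case: antiN; have := res_right s (T s) (T0 s - T s)%N.
    have := res_right s (T0 s) 0%N; lia.
  case: (leqP (K + (T0 s - T s)) m') => [le_u|lt_u].
    case: antiN; have := res_mid s (T s) (T0 s - T s)%N.
    have := res_mid s (T0 s) 0%N; lia.
  (* The left neighbour exists because [c > 0]. Its maximal variable lies in the first row and, as
     [q = 0], in column [cell_row s + 1]; wrapping forces [T s <= cell_row s]. *)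
  have [s' [row_s' col_s']] : exists s' : block_cell L c K d p,
      cell_row s' = cell_row s /\ cell_col s' = c.-1.
    by apply: block_cell_exists => //; rewrite /in_block; lia.
  have T0s' := T0E s'; rewrite row_s' col_s' /block_bot prednK // leqnn in T0s'.
  have T_s's : (T s' <= T s)%N.
    have /andP[/forallP/(_ s')/forallP/(_ s)/implyP le_row _] := T_ssyt.
    by apply: le_row; rewrite row_s' col_s' col_s eqxx /= prednK.
  have resT0' := res_left s' (T0 s') 0%N.
  rewrite row_s' col_s' in resT0'.
  exists s'; last by rewrite -val_eqE /=; lia.
  rewrite -/(res s' _); have := lt_res (T s) => lt_rT; apply: var_code_anti; lia.
split=> // x y; rewrite f_lead mnm_sumE; have lt_y := ltn_ord y.
have lt_x := ltn_ord x.
transitivity (\sum_(s : block_cell L c K d p)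
  ([&& (x < c) && (n'.+1 <= y + L + d), cell_row s == y + L + d - n'.+1
     & cell_col s == c.-1 - x]
   + [&& (x == K :> nat) && (n'.+1 <= y + L), cell_row s == y + L - n'.+1
     & cell_col s == c]
   + [&& (x < K) && (n'.+1 <= y + L), cell_row s == y + L - n'.+1
     & cell_col s == K + c - x]))%N; last first.
  rewrite !big_split /= !sum_block_cell // /in_block; congr (_ + _ + _)%N; lia.
apply: eq_bigr => s _; rewrite mnm1E var_index_eq -/(res s _).
have T0s := T0E s; have s_in := block_cellP le_pL s.
have lt_r : (res s (T0 s) < m'.+1)%N by apply: ltn_ord.
move: T0s s_in; rewrite /block_bot /in_block.
case: (ltngtP (cell_col s) c) => /= col_s T0s s_in.
- have resT0 : (res s (T0 s) + cell_col s + 1 = c)%N.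
    by rewrite (res_left s (T0 s) 0%N); lia.
  rewrite (_ : [&& _, _ & cell_col s == K + c - x]%N = false); last by lia.
  rewrite !andbF !addn0; congr nat_of_bool; apply/idP/idP; lia.
- have resT0 : (res s (T0 s) + cell_col s = K + c)%N.
    by rewrite (res_right s (T0 s) 0%N); lia.
  rewrite (_ : [&& _, _ & cell_col s == c.-1 - x]%N = false); last by lia.
  rewrite !andbF !add0n; congr nat_of_bool; apply/idP/idP; lia.
have resT0 : res s (T0 s) = K by rewrite (res_mid s (T0 s) 0%N); lia.
rewrite (_ : [&& _, _ & cell_col s == c.-1 - x]%N = false); last by lia.
rewrite (_ : [&& _, _ & cell_col s == K + c - x]%N = false); last by lia.
rewrite addn0 add0n; congr nat_of_bool; apply/idP/idP; lia.
Qed.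

(** * Leading exponents of the invariants *)

Lemma eq_loop_schur (A : comNzRingType) (N : nat) (y y' : 'I_N -> int -> A)
    (r : int) (la mu : seq nat) :
  (forall t c, y t c = y' t c) -> loop_schur y r la mu = loop_schur y' r la mu.
Proof. by move=> eq_y; apply: eq_bigr => T _; apply: eq_bigr => s _. Qed.

Lemma s_unbarred_reindex (F : comNzRingType) (m n' : nat) (r : int)
    (la mu : seq nat) :
  s_unbarred F m n'.+1 r la mu \mPo var_reindex F m n'.+1 =
  loop_schur (fun t c => 'X_(var_index t (residue n' (c - t.+1%:Z)))) r la mu.
Proof.
rewrite loop_schur_comp; apply: eq_loop_schur => t c.
by rewrite x_unbarredE xvar_reindex.
Qed.

Lemma s_barred_reindex (F : comNzRingType) (m' n : nat) (r : int)
    (la mu : seq nat) :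
  s_barred F m'.+1 n r la mu \mPo var_reindex F m'.+1 n =
  loop_schur (fun t c => 'X_(var_index (residue m' (c - t.+1%:Z)) t)) r la mu.
Proof.
rewrite loop_schur_comp; apply: eq_loop_schur => t c.
by rewrite x_barredE xvar_reindex.
Qed.

(** Since [i + j - m - 1] is negative and [K] is not, the quotient is negative; its absolute value
    is [q.+1]. This [q] is the one in the block lemmas. *)
Lemma Q_KP (m n i j : nat) : (0 < n)%N -> (i + j <= m)%N ->
  (Q_K m n i j < n)%N /\
  exists q, (m + 1 + Q_K m n i j = i + j + q.+1 * n)%N.
Proof.
move=> n_gt0 le_m; have n_neq0 : n%:Z != 0 by lia.
have ge0 := modz_ge0 (i%:Z + j%:Z - m%:Z - 1) n_neq0.
have lt_n := @ltz_pmod (i%:Z + j%:Z - m%:Z - 1) n%:Z n_gt0.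
have := divz_eq (i%:Z + j%:Z - m%:Z - 1) n%:Z.
rewrite /Q_K; set k := modz _ _ in ge0 lt_n *; set t := divz _ _ => tE.
split; first by lia.
have t_lt0 : t < 0 by nia.
by exists `|t|.-1; rewrite prednK; nia.
Qed.

(* Exponents of the leading monomials, with rows and columns numbered from 0. *)
Definition corner (m k x y : nat) : nat := (x + k < m)%N && (k <= y)%N.

Definition lead_exponent (m n : nat) (a : invariant_index m n) (x y : nat) : nat :=
  match a with
  | inl (inl ij) =>
      let i := (val ij).1.+1 in let j := (val ij).2.+1 in
      (corner m j x y + ((y.+1 == j) && (x < i))
       + corner m (n - Q_K m n i j) x y)%N
  | inl (inr ij) =>
      let i := (val ij).1.+1 in let j := (val ij).2.+1 in
      (corner m i x y + ((x == Q_K n m j i) && (n <= y + j))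
       + corner m (m - Q_K n m j i) x y)%N
  | inr k => corner m k x y
  end.

Lemma mlead_invariant (F : comNzRingType) (m' n' : nat)
    (a : invariant_index m'.+1 n'.+1) :
  let f := invariant_family F a \mPo var_reindex F m'.+1 n'.+1 in
  f != 0 /\ forall x y, mlead f (var_index x y) = lead_exponent a x y.
Proof.
case: a => [[[[i j] /= le_m]|[[i j] /= le_n]]|k] /=.
- have [lt_K [q Kq]] := Q_KP (ltn0Sn n') le_m.
  rewrite /Q_invariant s_unbarred_reindex /Q_outer /Q_inner.
  set K := Q_K _ _ _ _ in lt_K Kq *.
  have lt_i := ltn_ord i; have lt_j := ltn_ord j.
  have [|||||||||f_neq0 f_lead] := @mlead_min_block F m' n' (m'.+1 + K - n'.+1)
    (n'.+1 - j.+1) K (m'.+1 - i.+1 - j.+1) (m'.+1 + K - n'.+1 - i.+1) j.+1 q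
    (n'.+1 - j.+1 + 1)%N%:Z;
    do ?[by nia | by move=> _; split; nia].
  split=> // x y; rewrite f_lead /lead_exponent /corner /=.
  have lt_x := ltn_ord x; have lt_y := ltn_ord y.
  congr (nat_of_bool _ + nat_of_bool _ + nat_of_bool _)%N; nia.
- have [lt_K [q Kq]] := @Q_KP n'.+1 m'.+1 j.+1 i.+1 (ltn0Sn m') ltac:(lia).
  rewrite /barred_P_invariant s_barred_reindex /Q_outer /Q_inner.
  set K := Q_K _ _ _ _ in lt_K Kq *.
  have lt_i := ltn_ord i; have lt_j := ltn_ord j.
  have [||||||||f_neq0 f_lead] := @mlead_max_block F m' n' (n'.+1 + K - m'.+1)
    (m'.+1 - i.+1) K (n'.+1 - j.+1 - i.+1) (n'.+1 + K - m'.+1 - j.+1) i.+1 q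
    (m'.+1 - i.+1 + 1)%N%:Z;
    do ?by nia.
  split=> // x y; rewrite f_lead /lead_exponent /corner /=.
  have lt_x := ltn_ord x; have lt_y := ltn_ord y.
  congr (nat_of_bool _ + nat_of_bool _ + nat_of_bool _)%N; nia.
rewrite /shape_invariant s_unbarred_reindex; have lt_k := ltn_ord k.
(* With [L = 0] only the left columns remain; [J = 1] and [q = 0] fit [p = 0] and [r = n]. *)
have [|||||||||f_neq0 f_lead] := @mlead_min_block F m' n' 0
  (n'.+1 - k.+1 + 1) 0 (m'.+1 - k.+1 + 1) 0 1 0 n'.+1%:Z; try lia.
split=> // x y; rewrite f_lead /lead_exponent /corner.
have lt_x := ltn_ord x; have lt_y := ltn_ord y.
rewrite !ltn0 !andbF !addn0; congr nat_of_bool; lia.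
Qed.

(** * Linear independence of the exponent vectors *)

(** One elimination step: the coefficients single out [a0], up to unknowns already known to
    vanish. *)
Lemma sum_delta_eq0 (I : finType) (w delta : I -> int) (a0 : I) :
    \sum_a w a * delta a = 0 ->
    (forall a, delta a = 0 \/ w a = (a == a0)%:R) ->
  delta a0 = 0.
Proof.
move=> sum0 wE; rewrite -[RHS]sum0 (bigD1 a0) //= big1 => [|a neq_a].
  by case: (wE a0) => ->; rewrite ?eqxx ?mulr0 ?mul1r addr0.
by case: (wE a) => ->; rewrite ?mulr0 // (negPf neq_a) mul0r.
Qed.

Lemma lead_exponent_inj (m n : nat) (e e' : invariant_index m n -> nat) :
    (forall x y, (x < m)%N -> (y < n)%N ->
       \sum_a lead_exponent a x y * e a = \sum_a lead_exponent a x y * e' a)%N ->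
  e =1 e'.
Proof.
move=> eq_sum; pose delta a : int := (e a)%:Z - (e' a)%:Z.
have sum0 x y : (x < m)%N -> (y < n)%N ->
    \sum_a (lead_exponent a x y)%:Z * delta a = 0.
  move=> lt_x lt_y; under eq_bigr do rewrite mulrBr -!PoszM.
  by rewrite sumrB -!(big_morph _ PoszD (erefl 0%:Z)) eq_sum ?subrr.
have sumB x y x' y' : (x < m)%N -> (y < n)%N -> (x' < m)%N -> (y' < n)%N ->
    \sum_a ((lead_exponent a x y)%:Z - (lead_exponent a x' y')%:Z) * delta a = 0.
  move=> lt_x lt_y lt_x' lt_y'; under eq_bigr do rewrite mulrBl.
  by rewrite sumrB !sum0 ?subrr.
have deltaQ ij : delta (inl (inl ij)) = 0.
  case: ij => [[i j] /= le_m].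
  have lt_i : (i.+1 < m)%N by lia.
  (* Both positions satisfy [x + y <= m - 1], where a corner depends on the column alone. The row
     segments of the P-invariants lie in [x + y >= m]. *)
  have cornerE k : corner m k i j = corner m k i.+1 j by rewrite /corner; lia.
  apply: (sum_delta_eq0 (sumB i j i.+1 j (ltn_ord i) (ltn_ord j) lt_i (ltn_ord j))).
  case=> [[[[i' j'] /= le_m']|[[i' j'] /= le_n']]|k]; right.
  - rewrite (inj_eq inl_inj) (inj_eq inl_inj) -val_eqE /= xpair_eqE -!val_eqE /=.
    by rewrite !cornerE; lia.
  - rewrite !cornerE.
    have := Q_KP (leq_ltn_trans (leq0n _) (ltn_ord i)) (_ : j'.+1 + i'.+1 <= n)%N.
    by rewrite addnC => /(_ le_n')[lt_K [q Kq]]; nia.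
  by rewrite /= cornerE subrr.
have deltaP ij : delta (inl (inr ij)) = 0.
  case: ij => [[i j] /= le_n].
  have [lt_K [q Kq]] := @Q_KP n m j.+1 i.+1 (leq_ltn_trans (leq0n _) (ltn_ord i)) ltac:(lia).
  set K := Q_K n m j.+1 i.+1 in lt_K Kq.
  have lt_j := ltn_ord j; have lt_i := ltn_ord i.
  have lt_c : (n - j.+1 < n)%N by lia.
  have lt_c' : (n - j.+2 < n)%N by lia.
  (* Hence both positions satisfy [x + y >= m - 1], where a corner depends on the row alone. The
     column segments of the Q-invariants lie in [x + y <= m - 2]. *)
  have sum_ge : (m <= K + (n - j.+1))%N by nia.
  have cornerE k : corner m k K (n - j.+1) = corner m k K (n - j.+2).
    by rewrite /corner; lia.
  apply: (sum_delta_eq0 (sumB K (n - j.+1)%N K (n - j.+2)%N lt_K lt_c lt_K lt_c')).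
  case=> [[[[i' j'] /= le_m']|[[i' j'] /= le_n']]|k]; right.
  - by rewrite !cornerE /=; lia.
  - rewrite (inj_eq inl_inj) (inj_eq inr_inj) -val_eqE /= xpair_eqE -!val_eqE /=.
    have [lt_K' [q' Kq']] := @Q_KP n m j'.+1 i'.+1
      (leq_ltn_trans (leq0n _) (ltn_ord i)) ltac:(lia).
    set K' := Q_K n m j'.+1 i'.+1 in lt_K' Kq' *.
    (* For equal [j], the congruence makes [K] determine [i] modulo [m], hence [i] itself. *)
    have eq_i : (K == K') && (j == j' :> nat) = (i == i' :> nat) && (j == j' :> nat).
      apply: andb_id2r => /eqP eq_j; have lt_i' := ltn_ord i'.
      by case: (ltngtP q q') => cmp_q; [nia | nia | subst q'; lia].
    transitivity (((K == K') && (j == j' :> nat))%:R : int); last first.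
      by rewrite eq_i (eq_sym (i : nat)) (eq_sym (j : nat)).
    rewrite !cornerE; have -> : (n <= n - j.+1 + j'.+1)%N = (j <= j')%N by lia.
    have -> : (n <= n - j.+2 + j'.+1)%N = (j < j')%N by lia.
    by clear; case: (K == K'); case: (ltngtP j j'); lia.
  by rewrite /= cornerE subrr.
have deltaS (k : 'I_(minn m n)) : delta (inr k) = 0.
  have lt_k := ltn_ord k.
  (* On the antidiagonal [x + y = m - 1], [corner m k'] is 1 exactly when [k' <= y]. So [y = 0]
     isolates [k = 0], and the difference between [y = k] and [y = k - 1] isolates any other [k]. *)
  case: (posnP k) => [k0|k_gt0].
    apply: (sum_delta_eq0 (w := fun a => (lead_exponent a m.-1 0)%:Z)).
      by apply: sum0; lia.
    case=> [[ij|ij]|k']; [by left | by left | right].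
    by rewrite (inj_eq inr_inj) -val_eqE /= /corner; lia.
  apply: (sum_delta_eq0 (w := fun a => (lead_exponent a (m - k.+1) k)%:Z
                                       - (lead_exponent a (m - k) k.-1)%:Z)).
    by apply: sumB; lia.
  case=> [[ij|ij]|k']; [by left | by left | right].
  by rewrite (inj_eq inr_inj) -val_eqE /= /corner; lia.
move=> a; suff : delta a = 0 by rewrite /delta; lia.
by case: a => [[ij|ij]|k].
Qed.

Theorem proposition4p18 (R : realType) (m n : nat) (hm : (1 <= m)%N)
    (hn : (1 <= n)%N) :
  algebraically_independent (@invariant_family (complex R) m n).
Proof.
case: m hm => // m' _; case: n hn => // n' _.
apply: (algebraically_independent_comp (h := var_reindex _ m'.+1 n'.+1)).
apply: algebraically_independent_mlead => [a|e e' eq_lead].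
  by have [] := mlead_invariant (complex R) a.
apply: lead_exponent_inj => x y lt_x lt_y.
have := eq_lead (var_index (Ordinal lt_x) (Ordinal lt_y)).
under eq_bigr => a do rewrite (mlead_invariant (complex R) a).2.
by under [in RHS]eq_bigr => a do rewrite (mlead_invariant (complex R) a).2.
Qed.
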